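(* Let $\phi$ be a formula of any of the modal dependence logics $\mathbf{MT_0}$, $\mathbf{MID}$, $\mathbf{MD}^\vee$, $\mathbf{MD}^+$, $\mathbf{MD}$. If $\not\models\phi$, then there exist a finite Kripke model $\mathfrak{M}$ and a finite team $X$ of $\mathfrak{M}$ such that $\mathfrak{M},X\not\models\phi$.
   Context: **Languages.** Fix a set $\mathrm{Prop}$ of propositional variables. The full logic $\mathbf{MT_0}$ has classical formulas $\alpha::=p\mid\bot\mid\neg\alpha\mid\alpha\wedge\alpha\mid\alpha\otimes\alpha\mid\alpha\to\alpha\mid\Box\alpha\mid\Diamond\alpha$ and formulas $\phi::=\alpha\mid\; =\!(\alpha_1,\dots,\alpha_n,\beta)\mid\phi\wedge\phi\mid\phi\otimes\phi\mid\phi\vee\phi\mid\phi\to\phi\mid\Box\phi\mid\Diamond\phi$, where $n\ge 0$ and $\alpha,\alpha_i,\beta$ are classical. For non-classical $\phi$, $\neg\phi$ abbreviates $\phi\to\bot$. The others are fragments: $\mathbf{MID}$ has no $\otimes$; $\mathbf{MD}^\vee$ has no $\to$ (negation being applied to classical formulas only); $\mathbf{MD}^+$ has neither $\to$ nor $\vee$; $\mathbf{MD}$ is $\mathbf{MD}^+$ with dependence atoms restricted to $=\!(p_1,\dots,p_n,q)$ with propositional variables as arguments. **Team semantics.** A Kripke model is $\mathfrak{M}=(W,R,V)$ with $W\neq\emptyset$, $R\subseteq W\times W$, $V:\mathrm{Prop}\to\wp(W)$; it is finite if $W$ is finite. A team is any $X\subseteq W$. $R(X)=\{w\in W\mid\exists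 v\in X,\ vRw\}$, $R(w)=R(\{w\})$; $XRY$ means $Y\subseteq R(X)$ and $Y\cap R(w)\ne\emptyset$ for every $w\in X$. Satisfaction: - $\mathfrak{M},X\models p$ iff $X\subseteq V(p)$; $\mathfrak{M},X\models\bot$ iff $X=\emptyset$; $\mathfrak{M},X\models\neg\alpha$ iff $\mathfrak{M},\{w\}\not\models\alpha$ for all $w\in X$. - $\mathfrak{M},X\models\phi\wedge\psi$ iff both hold on $X$; $\mathfrak{M},X\models\phi\vee\psi$ iff $\mathfrak{M},X\models\phi$ or $\mathfrak{M},X\models\psi$. - $\mathfrak{M},X\models\phi\otimes\psi$ iff $X=Y\cup Z$ for some $Y,Z\subseteq X$ with $\mathfrak{M},Y\models\phi$, $\mathfrak{M},Z\models\psi$. - $\mathfrak{M},X\models\phi\to\psi$ iff for all $Y\subseteq X$, $\mathfrak{M},Y\models\phi$ implies $\mathfrak{M},Y\models\psi$. - $\mathfrak{M},X\models\Box\phi$ iff $\mathfrak{M},R(X)\models\phi$; $\mathfrak{M},X\models\Diamond\phi$ iff there is $Y\subseteq W$ with $XRY$ and $\mathfrak{M},Y\models\phi$. - $\mathfrak{M},X\models\;=\!(\alpha_1,\dots,\alpha_n,\beta)$ iff for all $w,u\in X$: if ($\mathfrak{M},\{w\}\models\alpha_i\Leftrightarrow\mathfrak{M},\{u\}\models\alpha_i$) for all $1\le i\le n$, then ($\mathfrak{M},\{w\}\models\beta\Leftrightarrow\mathfrak{M},\{u\}\models\beta$). $\models\phi$ means $\mathfrak{M},X\models\phi$ for all models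 $\mathfrak{M}$ and all teams $X$ of $\mathfrak{M}$. *)

(* Defs.v *)
From mathcomp Require Import all_boot.
From mathcomp Require Import boolp classical_sets cardinality.

Set Implicit Arguments.
Unset Strict Implicit.
Unset Printing Implicit Defensive.

Local Open Scope classical_set_scope.

Inductive cform (Var : Type) : Type :=
| CVar (p : Var)
| CBot
| CNeg (a : cform Var)
| CAnd (a b : cform Var)
| CTensor (a b : cform Var)
| CImp (a b : cform Var)
| CBox (a : cform Var)
| CDia (a : cform Var).

(* Formulas of MT_0.  A classical formula may be written in several ways, e.g.
   FCl (CAnd a b) and FAnd (FCl a) (FCl b); these have the same satisfaction
   clause.  Negation of a non-classical f is FImp f (FCl (CBot _)). *)
Inductive form (Var : Type) : Type :=
| FCl (a : cform Var)
| FDep (n : nat) (a : n.-tuple (cform Var)) (b : cform Var)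
| FAnd (f g : form Var)
| FTensor (f g : form Var)
| FOr (f g : form Var)
| FImp (f g : form Var)
| FBox (f : form Var)
| FDia (f : form Var).

Arguments CBot {Var}.

Inductive logic := MT0 | MID | MDvee | MDplus | MD.

Definition has_tensor (L : logic) : bool :=
  match L with MID => false | _ => true end.

Definition has_imp (L : logic) : bool :=
  match L with MT0 | MID => true | _ => false end.

Definition has_vee (L : logic) : bool :=
  match L with MT0 | MID | MDvee => true | _ => false end.

Definition has_only_var_atoms (L : logic) : bool :=
  match L with MD => true | _ => false end.

Definition is_var (Var : Type) (a : cform Var) : bool :=
  match a with CVar _ => true | _ => false end.

Fixpoint in_clogic (Var : Type) (L : logic) (a : cform Var) : bool :=
  match a with
  | CVar _ | CBot => true
  | CNeg a | CBox a | CDia a => in_clogic L a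
  | CAnd a b => in_clogic L a && in_clogic L b
  | CTensor a b => [&& has_tensor L, in_clogic L a & in_clogic L b]
  | CImp a b => [&& has_imp L, in_clogic L a & in_clogic L b]
  end.

Fixpoint in_logic (Var : Type) (L : logic) (f : form Var) : bool :=
  match f with
  | FCl a => in_clogic L a
  | FDep n a b =>
      let ok := if has_only_var_atoms L then @is_var Var
                else @in_clogic Var L in
      all ok a && ok b
  | FAnd f g => in_logic L f && in_logic L g
  | FTensor f g => [&& has_tensor L, in_logic L f & in_logic L g]
  | FOr f g => [&& has_vee L, in_logic L f & in_logic L g]
  | FImp f g => [&& has_imp L, in_logic L f & in_logic L g]
  | FBox f | FDia f => in_logic L f
  end.

Record kripke_model (Var : Type) := KripkeModel {
  world : Type;
  world_nonempty : [set: world] !=set0;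
  acc : world -> world -> Prop;
  valuation : Var -> set world
}.

Arguments acc {Var} _ _ _.
Arguments valuation {Var} _ _ _.

Definition finite_model (Var : Type) (M : kripke_model Var) : Prop :=
  finite_set [set: world M].

Definition succs (W : Type) (R : W -> W -> Prop) (X : set W) : set W :=
  [set w | exists2 v, X v & R v w].

Definition team_acc (W : Type) (R : W -> W -> Prop) (X Y : set W) : Prop :=
  Y `<=` succs R X /\ forall w, X w -> (Y `&` succs R [set w]) !=set0.

Definition team_prop (W : Type) := set W -> Prop.

Definition t_and (W : Type) (P Q : team_prop W) : team_prop W :=
  fun X => P X /\ Q X.

Definition t_or (W : Type) (P Q : team_prop W) : team_prop W :=
  fun X => P X \/ Q X.

Definition t_tensor (W : Type) (P Q : team_prop W) : team_prop W :=
  fun X => exists Y Z : set W,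
    [/\ Y `<=` X, Z `<=` X, X = Y `|` Z, P Y & Q Z].

Definition t_imp (W : Type) (P Q : team_prop W) : team_prop W :=
  fun X => forall Y : set W, Y `<=` X -> P Y -> Q Y.

Definition t_box (W : Type) (R : W -> W -> Prop) (P : team_prop W) :
    team_prop W :=
  fun X => P (succs R X).

Definition t_dia (W : Type) (R : W -> W -> Prop) (P : team_prop W) :
    team_prop W :=
  fun X => exists2 Y : set W, team_acc R X Y & P Y.

Fixpoint csat (Var : Type) (M : kripke_model Var) (a : cform Var) {struct a} :
    team_prop (world M) :=
  match a with
  | CVar p => fun X => X `<=` valuation M p
  | CBot => fun X => X = set0
  | CNeg a => fun X => forall w, X w -> ~ csat a [set w]
  | CAnd a b => t_and (csat a) (csat b)
  | CTensor a b => t_tensor (csat a) (csat b)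
  | CImp a b => t_imp (csat a) (csat b)
  | CBox a => t_box (acc M) (csat a)
  | CDia a => t_dia (acc M) (csat a)
  end.

Fixpoint fsat (Var : Type) (M : kripke_model Var) (f : form Var) :
    team_prop (world M) :=
  match f with
  | FCl a => csat a
  | FDep n a b => fun X => forall w u, X w -> X u ->
      (forall i : 'I_n, csat (tnth a i) [set w] <-> csat (tnth a i) [set u]) ->
      (csat b [set w] <-> csat b [set u])
  | FAnd f g => t_and (fsat f) (fsat g)
  | FTensor f g => t_tensor (fsat f) (fsat g)
  | FOr f g => t_or (fsat f) (fsat g)
  | FImp f g => t_imp (fsat f) (fsat g)
  | FBox f => t_box (acc M) (fsat f)
  | FDia f => t_dia (acc M) (fsat f)
  end.

Definition sat (Var : Type) (M : kripke_model Var) (X : set (world M))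
    (f : form Var) : Prop :=
  fsat f X.

Definition valid (Var : Type) (f : form Var) : Prop :=
  forall (M : kripke_model Var) (X : set (world M)), sat X f.

(* Main.v *)
Require Import Defs.
From mathcomp Require Import all_boot.
From mathcomp Require Import boolp classical_sets cardinality.

(** Two teams are k-bisimilar when each world of either one is k-bisimilar to
    some world of the other.  A team formula of modal depth at most k cannot
    distinguish k-bisimilar teams: a subteam, or a team of successors, of one
    side is matched by the set of all worlds on the other side bisimilar to one
    of its elements.  With finitely many variables there are finitely many
    k-bisimulation types, and these are the worlds of one finite model
    containing a k-bisimilar copy of every world of every model.  A countermodel
    of [phi] is transported to that model, for k the modal depth of [phi]. *)

Set Implicit Arguments.
Unset Strict Implicit.
Unset Printing Implicit Defensive.

Local Open Scope classical_set_scope.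

(** [{classic Var}] equips the arbitrary type [Var] with a classical decidable equality, which list
    membership and the finite type [seq_sub s] require. *)
Fixpoint cvars {Var : Type} (a : cform Var) : seq {classic Var} :=
  match a with
  | CVar p => [:: p : {classic Var}]
  | CBot => [::]
  | CNeg a | CBox a | CDia a => cvars a
  | CAnd a b | CTensor a b | CImp a b => cvars a ++ cvars b
  end.

Fixpoint fvars {Var : Type} (f : form Var) : seq {classic Var} :=
  match f with
  | FCl a => cvars a
  | FDep n a b => flatten [seq cvars (tnth a i) | i : 'I_n] ++ cvars b
  | FAnd f g | FTensor f g | FOr f g | FImp f g => fvars f ++ fvars g
  | FBox f | FDia f => fvars f
  end.

Fixpoint cdepth {Var : Type} (a : cform Var) : nat :=
  match a with
  | CVar _ | CBot => 0
  | CNeg a => cdepth a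
  | CAnd a b | CTensor a b | CImp a b => maxn (cdepth a) (cdepth b)
  | CBox a | CDia a => (cdepth a).+1
  end.

Fixpoint fdepth {Var : Type} (f : form Var) : nat :=
  match f with
  | FCl a => cdepth a
  | FDep n a b => maxn (\max_(i < n) cdepth (tnth a i)) (cdepth b)
  | FAnd f g | FTensor f g | FOr f g | FImp f g => maxn (fdepth f) (fdepth g)
  | FBox f | FDia f => (fdepth f).+1
  end.

(** * Bounded bisimulation between worlds *)

Section Bisimulation.
Context {Var : Type} (s : seq {classic Var}).

Lemma subset_cat (t u : seq {classic Var}) :
  {subset t ++ u <= s} -> {subset t <= s} /\ {subset u <= s}.
Proof. by move=> tu; split=> p pt; apply: tu; rewrite mem_cat pt ?orbT. Qed.

Definition same_atoms (M N : kripke_model Var) (w : world M) (x : world N) :=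
  forall p : {classic Var}, p \in s -> (valuation M p w <-> valuation N p x).

Fixpoint bisim (k : nat) (M N : kripke_model Var) (w : world M) (x : world N) :
    Prop :=
  if k is k'.+1 then
    [/\ same_atoms w x,
        forall v, acc M w v -> exists2 y, acc N x y & bisim k' v y &
        forall y, acc N x y -> exists2 v, acc M w v & bisim k' v y]
  else same_atoms w x.

Lemma bisim_atoms k (M N : kripke_model Var) (w : world M) (x : world N) :
  bisim k w x -> same_atoms w x.
Proof. by case: k => [|k] //= []. Qed.

Lemma bisim_sym k (M N : kripke_model Var) (w : world M) (x : world N) :
  bisim k w x -> bisim k x w.
Proof.
elim: k w x => [|k IH] w x /=; first by move=> h p /h ->.
case=> h forth back; split=> [p /h -> //|y /back|v /forth] [u].
  by exists u => //; exact: IH.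
by exists u => //; exact: IH.
Qed.

(** Answers in [N] are pushed forward along [f], and every successor of [f x] comes from one of [x].
    This serves to embed each stage of the universal model into the next. *)
Lemma bisim_bounded_morphism k (M N N' : kripke_model Var)
    (f : world N -> world N') :
  (forall p x, valuation N p x <-> valuation N' p (f x)) ->
  (forall x y, acc N x y -> acc N' (f x) (f y)) ->
  (forall x z, acc N' (f x) z -> exists2 y, z = f y & acc N x y) ->
  forall (w : world M) (x : world N), bisim k w x -> bisim k w (f x).
Proof.
move=> fV fR fRV; elim: k => [|k IH] w x /=; first by move=> h p /h ->.
case=> h forth back; split=> [p /h -> //|v /forth[y xy vy]|z].
  by exists (f y); [exact: fR|exact: IH].
by move=> /fRV[y -> /back[v wv vy]]; exists v => //; exact: IH.
Qed.

(** * Bounded bisimulation between teams *)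

Definition tbisim (k : nat) (M N : kripke_model Var) (X : set (world M))
    (Y : set (world N)) : Prop :=
  (forall w, X w -> exists2 x, Y x & bisim k w x) /\
  (forall x, Y x -> exists2 w, X w & bisim k w x).

(** [Y] is the ambient team: one being split or restricted, a set of successors, or a whole
    model. *)
Definition tmatch (k : nat) (M N : kripke_model Var) (X : set (world M))
    (Y : set (world N)) : set (world N) :=
  [set x | Y x /\ exists2 w, X w & bisim k w x].

Section Teams.
Context {M N : kripke_model Var}.
Implicit Types (X : set (world M)) (Y : set (world N)).

Lemma tbisim_sym k X Y : tbisim k X Y -> tbisim k Y X.
Proof.
by case=> XY YX; split=> [x /YX|w /XY] [u ? /bisim_sym]; exists u.
Qed.

Lemma tbisim_set1 k (w : world M) (x : world N) :
  bisim k w x -> tbisim k [set w] [set x].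
Proof. by move=> wx; split=> _ ->; [exists x|exists w]. Qed.

Lemma tbisim_match k X0 X Y :
  X0 `<=` X -> tbisim k X Y -> tbisim k X0 (tmatch k X0 Y).
Proof.
move=> X0X [XY YX]; split=> [w X0w|x [_ []]]; last by move=> w; exists w.
by have [x Yx wx] := XY _ (X0X _ X0w); exists x => //; split=> //; exists w.
Qed.

Lemma tbisim_succs k X Y :
  tbisim k.+1 X Y -> tbisim k (succs (acc M) X) (succs (acc N) Y).
Proof.
case=> XY YX; split=> [v [w /XY[x Yx [_ forth _]] /forth[y xy vy]]|].
  by exists y => //; exists x.
move=> y [x /YX[w Xw [_ _ back]] /back[v wv vy]].
by exists v => //; exists w.
Qed.

End Teams.

(** * Invariance of the connectives *)

Definition invariant (k : nat)
    (P : forall M : kripke_model Var, team_prop (world M)) : Prop :=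
  forall (M N : kripke_model Var) (X : set (world M)) (Y : set (world N)),
    tbisim k X Y -> P M X -> P N Y.

Section Invariance.
Implicit Types P Q : forall M : kripke_model Var, team_prop (world M).

Lemma invariant_set1 k P (M N : kripke_model Var) (w : world M) (x : world N) :
  invariant k P -> bisim k w x -> P M [set w] <-> P N [set x].
Proof.
move=> iP wx; split; first exact/iP/tbisim_set1.
exact/iP/tbisim_sym/tbisim_set1.
Qed.

Lemma invariant_var k (p : {classic Var}) : p \in s ->
  invariant k (fun M X => X `<=` valuation M p).
Proof.
by move=> ps M N X Y [_ YX] Xp x /YX[w /Xp wp /bisim_atoms/(_ _ ps)] [/(_ wp)].
Qed.

Lemma invariant_bot k : invariant k (fun M X => X = set0).
Proof.
by move=> M N X Y [_ YX] X0; apply/seteqP; split=> x // /YX[w]; rewrite X0.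
Qed.

Lemma invariant_neg k P : invariant k P ->
  invariant k (fun M X => forall w, X w -> ~ P M [set w]).
Proof.
move=> iP M N X Y [_ YX] nP x /YX[w /nP nPw wx] Px; apply: nPw.
by apply/(invariant_set1 iP wx).
Qed.

Lemma invariant_and k P Q : invariant k P -> invariant k Q ->
  invariant k (fun M => t_and (P M) (Q M)).
Proof. by move=> iP iQ M N X Y XY [/(iP _ _ _ _ XY) ? /(iQ _ _ _ _ XY)]. Qed.

Lemma invariant_or k P Q : invariant k P -> invariant k Q ->
  invariant k (fun M => t_or (P M) (Q M)).
Proof.
move=> iP iQ M N X Y XY [/(iP _ _ _ _ XY)|/(iQ _ _ _ _ XY)]; [by left|by right].
Qed.

Lemma invariant_tensor k P Q : invariant k P -> invariant k Q ->
  invariant k (fun M => t_tensor (P M) (Q M)).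
Proof.
move=> iP iQ M N X Y XY [X1 [X2 [X1X X2X XE P1 Q2]]].
exists (tmatch k X1 Y), (tmatch k X2 Y); split.
- by move=> x [].
- by move=> x [].
(* The two matched teams cover [Y]: each of its worlds is bisimilar to a world of [X], which lies in
   [X1] or [X2]. *)
- apply/seteqP; split=> [x Yx|x [] []//].
  have [_ /(_ x Yx)[w]] := XY.
  by rewrite XE => -[Xw|Xw] wx; [left|right]; split=> //; exists w.
- exact: iP (tbisim_match X1X XY) P1.
- exact: iQ (tbisim_match X2X XY) Q2.
Qed.

(** The given subteam lies in [Y], so it is matched back into [X]: [P] travels from [N] to [M], and
    [Q] returns. Symmetry of [tbisim] makes the one-way implication in [invariant] enough for
    both. *)
Lemma invariant_imp k P Q : invariant k P -> invariant k Q ->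
  invariant k (fun M => t_imp (P M) (Q M)).
Proof.
move=> iP iQ M N X Y XY PQ Y0 Y0Y PY0.
have Y0X0 := tbisim_match Y0Y (tbisim_sym XY).
apply: iQ (tbisim_sym Y0X0) _; apply: PQ; first by move=> w [].
exact: iP Y0X0 PY0.
Qed.

Lemma invariant_box k P : invariant k P ->
  invariant k.+1 (fun M => t_box (acc M) (P M)).
Proof. by move=> iP M N X Y /tbisim_succs XY; exact: iP. Qed.

Lemma invariant_dia k P : invariant k P ->
  invariant k.+1 (fun M => t_dia (acc M) (P M)).
Proof.
move=> iP M N X Y XY [Z [ZX XZ] PZ].
(* Each [x] in [Y] sees a world of this team: a bisimilar [w] in [X] has a successor [v] in [Z], and
   the forth condition moves [v] to a successor of [x]. *)
exists (tmatch k Z (succs (acc N) Y)).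
  split=> [y []//|x Yx].
  have [_ /(_ x Yx)[w /XZ[v [Zv [_ -> wv]]] [_ forth _]]] := XY.
  have [y xy vy] := forth v wv; exists y; split; last by exists x.
  by split; [exists x|exists v].
exact: iP (tbisim_match ZX (tbisim_succs XY)) PZ.
Qed.

Lemma invariant_csat k (a : cform Var) :
  {subset cvars a <= s} -> (cdepth a <= k)%N ->
  invariant k (fun M => @csat Var M a).
Proof.
elim: a k => /= [p||a IH|a IHa b IHb|a IHa b IHb|a IHa b IHb|a IH|a IH] k.
- by move=> ps _; apply/invariant_var/ps; rewrite inE.
- by move=> _ _; exact: invariant_bot.
- by move=> ? ?; apply: (invariant_neg (IH k _ _)).
- move=> /subset_cat[? ?]; rewrite geq_max => /andP[? ?].
  by apply: (invariant_and (IHa k _ _) (IHb k _ _)).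
- move=> /subset_cat[? ?]; rewrite geq_max => /andP[? ?].
  by apply: (invariant_tensor (IHa k _ _) (IHb k _ _)).
- move=> /subset_cat[? ?]; rewrite geq_max => /andP[? ?].
  by apply: (invariant_imp (IHa k _ _) (IHb k _ _)).
- by case: k => // k ? ?; apply: (invariant_box (IH k _ _)).
- by case: k => // k ? ?; apply: (invariant_dia (IH k _ _)).
Qed.

Lemma invariant_fsat k (f : form Var) :
  {subset fvars f <= s} -> (fdepth f <= k)%N ->
  invariant k (fun M => @fsat Var M f).
Proof.
elim: f k => /= [a|n a b|f IHf g IHg|f IHf g IHg|f IHf g IHg|f IHf g IHg
  |f IH|f IH] k.
- exact: invariant_csat.
- move=> /subset_cat[sa sb]; rewrite geq_max => /andP[/bigmax_leqP ka kb].
  have ia i : invariant k (fun M => @csat Var M (tnth a i)).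
    apply: invariant_csat (ka i isT) => p pa; apply: sa.
    by apply/flattenP; exists (cvars (tnth a i)) => //; apply/mapP; exists i;
      rewrite ?mem_enum.
  have ib := invariant_csat sb kb.
  (* The atom only compares truth on singletons, so it is tested on worlds [w], [v] of [X] bisimilar
     to [x], [y]. *)
  move=> M N X Y [_ YX] dep x y /YX[w Xw wx] /YX[v Xv vy] xya.
  apply: (iff_trans (iff_sym (invariant_set1 ib wx))).
  apply: (iff_trans _ (invariant_set1 ib vy)).
  apply: dep => // i.
  apply: (iff_trans (invariant_set1 (ia i) wx)).
  exact: iff_trans (xya i) (iff_sym (invariant_set1 (ia i) vy)).
- move=> /subset_cat[? ?]; rewrite geq_max => /andP[? ?].
  by apply: (invariant_and (IHf k _ _) (IHg k _ _)).
- move=> /subset_cat[? ?]; rewrite geq_max => /andP[? ?].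
  by apply: (invariant_tensor (IHf k _ _) (IHg k _ _)).
- move=> /subset_cat[? ?]; rewrite geq_max => /andP[? ?].
  by apply: (invariant_or (IHf k _ _) (IHg k _ _)).
- move=> /subset_cat[? ?]; rewrite geq_max => /andP[? ?].
  by apply: (invariant_imp (IHf k _ _) (IHg k _ _)).
- by case: k => // k ? ?; apply: (invariant_box (IH k _ _)).
- by case: k => // k ? ?; apply: (invariant_dia (IH k _ _)).
Qed.

End Invariance.

(** * The finite universal model *)

Definition atoms_of (M : kripke_model Var) (w : world M) : {set seq_sub s} :=
  [set i | `[<valuation M (ssval i : {classic Var}) w>]]%SET.

(** Defined for every [p], as a valuation must be; false when [p] is outside [s]. *)
Definition holds_in (p : {classic Var}) (A : {set seq_sub s}) : Prop :=
  exists2 i, i \in A & ssval i = p.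

Lemma atoms_ofP (M : kripke_model Var) (w : world M) (p : {classic Var}) :
  p \in s -> valuation M p w <-> holds_in p (atoms_of w).
Proof.
move=> ps; split=> [pw|[i + <-]]; last by rewrite inE => /asboolP.
by exists (SeqSub ps) => //; rewrite inE; apply/asboolP.
Qed.

(* The worlds of the model for [k.+1] are those of the model for [k], together
   with one world for each choice of true variables and of successors. *)
Lemma finite_universal_model k :
  exists (T : finType) (T0 : [set: T] !=set0) (R : T -> T -> Prop)
         (V : Var -> set T),
    forall (M : kripke_model Var) (w : world M),
      exists x : T, @bisim k M (KripkeModel T0 R V) w x.
Proof.
elim: k => [|k [T [T0 [R [V IH]]]]].
  have T0 : [set: {set seq_sub s}] !=set0 by exists finset.set0.
  exists {set seq_sub s}, T0, (fun _ _ => False), holds_in.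
  by move=> M w; exists (atoms_of w) => p /atoms_ofP.
pose T' : finType := (T + {set seq_sub s} * {set T})%type.
have T'0 : [set: T'] !=set0 by have [t _] := T0; exists (inl t).
(* Old worlds see only old worlds, exactly as before, so [inl] is a bounded morphism; new worlds
   also see only old ones. *)
pose R' (x y : T') := match x, y with
  | inl t, inl u => R t u
  | inr (_, B), inl u => u \in B
  | _, inr _ => False end.
pose V' p : set T' := fun x => match x with
  | inl t => V p t
  | inr (A, _) => holds_in p A end.
exists T', T'0, R', V' => M w.
have inl_bisim (v : world M) t : @bisim k M (KripkeModel T0 R V) v t ->
    @bisim k M (KripkeModel T'0 R' V') v (inl t).
  apply: (@bisim_bounded_morphism k M (KripkeModel T0 R V)
    (KripkeModel T'0 R' V') inl) => //= x [y|//] xy.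
  by exists y.
(* The successors are all old worlds bisimilar to some successor of [w]: back holds by this choice,
   forth by the induction hypothesis. *)
exists (inr (atoms_of w, [set t | `[<exists2 v, acc M w v &
  @bisim k M (KripkeModel T0 R V) v t>]]%SET)); split=> [p /atoms_ofP//|v wv|].
  have [t vt] := IH M v; exists (inl t); last exact: inl_bisim.
  by rewrite /= inE; apply/asboolP; exists v.
move=> [t|//] /=; rewrite inE => /asboolP[v wv vt].
by exists v => //; exact: inl_bisim.
Qed.

End Bisimulation.

Theorem theorem2p17 (Var : Type) (L : logic) (phi : form Var) :
  in_logic L phi ->
  ~ valid phi ->
  exists (M : kripke_model Var) (X : set (world M)),
    [/\ finite_model M, finite_set X & ~ sat X phi].
Proof.
move=> _ /existsNP[M /existsNP[X nphi]].
have [T [T0 [R [V univ]]]] := finite_universal_model (fvars phi) (fdepth phi).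
pose N := KripkeModel T0 R V.
pose Y : set (world N) := tmatch (fvars phi) (fdepth phi) X setT.
have XY : tbisim (fvars phi) (fdepth phi) X Y.
  split=> [w Xw|x []//]; have [x wx] := univ M w.
  by exists x => //; split=> //; exists w.
exists N, Y; split; [exact: finite_finset|exact: finite_finset|move=> phiY].
(* Satisfaction on [Y] would carry over to [X], so invariance is used from [N] to [M]. *)
apply: nphi; apply: (@invariant_fsat _ (fvars phi) (fdepth phi) phi) phiY => //.
exact: tbisim_sym.
Qed.
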